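(* Let $\mathcal{B}^t$ be the filtration generated by the random variables $\{\xi^0,\zeta^0,\xi^1,\zeta^1,\dots,\xi^{t-1},\zeta^{t-1}\}$, such that the $t$-th iterate $\boldsymbol{\mathscr{Y}}^t$ is determined conditioned on $\mathcal{B}^t$. Suppose that $\boldsymbol{q}^{\ne\xi^t}=[p_1,\dots,p_{J_{\xi^t}}]^\top$ is a probability distribution and that the stochastic gradient $\mathfrak{g}_{\xi^t}^t$ is computed (see context) from $|\mathcal{F}_{\xi^t}|$ indices sampled according to $\boldsymbol{q}^{\ne\xi^t}$. Then $$\mathbb{E}_{\zeta^t}\left[\left\|\mathfrak{g}_{\xi^t}^t-\nabla_{\mathbf{G}_{\xi^t(2)}}f(\boldsymbol{\mathscr{Y}}^t)\right\|_F^2\,\middle|\,\mathcal{B}^t,\xi^t\right]=\frac{1}{|\mathcal{F}_{\xi^t}|}\sum_{j_f=1}^{J_{\xi^t}}\frac{1}{p_{j_f}}\left\|\mathbf{R}_{[\xi^t]}^t(:,j_f)\right\|_2^2\left\|(\mathbf{G}^{\ne\xi^t}_{[2]})^t(j_f,:)\right\|_2^2-\frac{1}{|\mathcal{F}_{\xi^t}|}\left\|\nabla_{\mathbf{G}_{\xi^t(2)}}f(\boldsymbol{\mathscr{Y}}^t)\right\|_F^2.$$ Further, if $$\boldsymbol{q}^{\ne\xi^t}(i)=\frac{\left\|\mathbf{R}_{[\xi^t]}^t(:,i)\right\|_2\left\|(\mathbf{G}^{\ne\xi^t}_{[2]})^t(i,:)\right\|_2}{\sum_{i'=1}^{J_{\xi^t}}\left\|\mathbf{R}_{[\xi^t]}^t(:,i')\right\|_2\left\|(\mathbf{G}^{\ne\xi^t}_{[2]})^t(i',:)\right\|_2},\qquad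 i\in\{1,\dots,J_{\xi^t}\},$$ where $\mathbf{R}_{[\xi^t]}^t=\mathbf{X}_{[\xi^t]}^t-\mathbf{X}_{[\xi^t]}$ and $\mathbf{X}_{[\xi^t]}^t=\mathbf{G}_{\xi^t(2)}^t((\mathbf{G}^{\ne\xi^t}_{[2]})^t)^\top$, then $\mathbb{E}_{\zeta^t}\left[\left\|\mathfrak{g}_{\xi^t}^t-\nabla_{\mathbf{G}_{\xi^t(2)}}f(\boldsymbol{\mathscr{Y}}^t)\right\|_F^2\,\middle|\,\mathcal{B}^t,\xi^t\right]$ achieves its minimum, which is $$\mathbb{E}_{\zeta^t}\left[\left\|\mathfrak{g}_{\xi^t}^t-\nabla_{\mathbf{G}_{\xi^t(2)}}f(\boldsymbol{\mathscr{Y}}^t)\right\|_F^2\,\middle|\,\mathcal{B}^t,\xi^t\right]=\frac{1}{|\mathcal{F}_{\xi^t}|}\left(\sum_{j_f=1}^{J_{\xi^t}}\left\|\mathbf{R}_{[\xi^t]}^t(:,j_f)\right\|_2\left\|(\mathbf{G}^{\ne\xi^t}_{[2]})^t(j_f,:)\right\|_2\right)^2-\frac{1}{|\mathcal{F}_{\xi^t}|}\left\|\nabla_{\mathbf{G}_{\xi^t(2)}}f(\boldsymbol{\mathscr{Y}}^t)\right\|_F^2 .$$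
   Context: Multi-index: $\overline{i_1i_2\cdots i_N}=i_1+(i_2-1)I_1+\cdots+(i_N-1)I_1\cdots I_{N-1}$. Tensor ring (TR) model: given cores $\boldsymbol{\mathscr{G}}_n\in\mathbb{R}^{R_n\times I_n\times R_{n+1}}$, $n=1,\dots,N$, with $R_{N+1}=R_1$, let $\mathbf{G}_n(i_n)=\boldsymbol{\mathscr{G}}_n(:,i_n,:)\in\mathbb{R}^{R_n\times R_{n+1}}$. $\mathrm{TR}(\{\boldsymbol{\mathscr{G}}_n\}_{n=1}^N)$ is the tensor in $\mathbb{R}^{I_1\times\cdots\times I_N}$ with entries $\mathrm{Trace}(\mathbf{G}_1(i_1)\cdots\mathbf{G}_N(i_N))$. Core indices are understood cyclically modulo $N$. A data tensor $\boldsymbol{\mathscr{X}}\in\mathbb{R}^{I_1\times\cdots\times I_N}$ is given. Unfoldings: $J_n=\prod_{k\ne n}I_k$. $\mathbf{X}_{[n]}\in\mathbb{R}^{I_n\times J_n}$ has entries $\mathbf{X}_{[n]}(i_n,\overline{i_{n+1}\cdots i_Ni_1\cdots i_{n-1}})=\boldsymbol{\mathscr{X}}(i_1,\dots,i_N)$. $\mathbf{G}_{n(2)}\in\mathbb{R}^{I_n\times R_nR_{n+1}}$ has entries $\mathbf{G}_{n(2)}(i,\overline{r\,r'})=\boldsymbol{\mathscr{G}}_n(r,i,r')$. The subchain tensor $\boldsymbol{\mathscr{G}}^{\ne n}\in\mathbb{R}^{R_{n+1}\times J_n\times R_n}$ has lateral slice number $\overline{i_{n+1}\cdots i_Ni_1\cdots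 i_{n-1}}$ equal to $\mathbf{G}_{n+1}(i_{n+1})\cdots\mathbf{G}_N(i_N)\mathbf{G}_1(i_1)\cdots\mathbf{G}_{n-1}(i_{n-1})$, and $\mathbf{G}^{\ne n}_{[2]}\in\mathbb{R}^{J_n\times R_nR_{n+1}}$ has entries $\mathbf{G}^{\ne n}_{[2]}(j,\overline{r\,r'})=\boldsymbol{\mathscr{G}}^{\ne n}(r',j,r)$. Objective: for $\boldsymbol{\mathscr{Y}}=(\boldsymbol{\mathscr{G}}_1,\dots,\boldsymbol{\mathscr{G}}_N)$, $f(\boldsymbol{\mathscr{Y}})=\frac12\|\mathrm{TR}(\{\boldsymbol{\mathscr{G}}_n\})-\boldsymbol{\mathscr{X}}\|_F^2=\frac12\|\mathbf{X}_{[n]}-\mathbf{G}_{n(2)}(\mathbf{G}^{\ne n}_{[2]})^\top\|_F^2$ for each $n$, with $\nabla_{\mathbf{G}_{n(2)}}f(\boldsymbol{\mathscr{Y}})=\mathbf{G}_{n(2)}(\mathbf{G}^{\ne n}_{[2]})^\top\mathbf{G}^{\ne n}_{[2]}-\mathbf{X}_{[n]}\mathbf{G}^{\ne n}_{[2]}$. Probability distribution: a vector with entries in $[0,1]$ summing to $1$. Random variables: at iteration $t$ of a block-randomized stochastic gradient method, $\xi^t\in\{1,\dots,N\}$ selects the mode and $\zeta^t$ selects the sampled indices in $\{1,\dots,J_{\xi^t}\}$ (the mode-$\xi^t$ fibers of $\boldsymbol{\mathscr{X}}$). A superscript $t$ means evaluation at $\boldsymbol{\mathscr{Y}}^t$.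 Stochastic gradient: given $\xi^t=n$ and a probability distribution $[p_1,\dots,p_{J_n}]^\top$, draw $|\mathcal{F}_n|$ indices $j_1,\dots,j_{|\mathcal{F}_n|}$ independently with replacement from it (they form $\mathcal{F}_n$) and set, at $\boldsymbol{\mathscr{Y}}^t$, $$\mathfrak{g}_n^t=\frac{1}{|\mathcal{F}_n|J_n}\left(\mathbf{G}_{n(2)}(\mathbf{G}^{\ne n}_{[2]}(\mathcal{F}_n,:))^\top\mathbf{D}\,\mathbf{G}^{\ne n}_{[2]}(\mathcal{F}_n,:)-\mathbf{X}_{[n]}(:,\mathcal{F}_n)\mathbf{D}\,\mathbf{G}^{\ne n}_{[2]}(\mathcal{F}_n,:)\right),\quad \mathbf{D}=\mathrm{diag}\left(\tfrac1{p_{j_1}},\dots,\tfrac1{p_{j_{|\mathcal{F}_n|}}}\right).$$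
   Formalization: The identities fail for J_n>1 with the factor 1/J_n in the stochastic gradient, so they are proved for J_n times it; p_j=0 is allowed only where the product of the residual column and subchain row norms is 0, also for the competitors in the minimum. *)

(* Defs.v *)
From HB Require Import structures.
From mathcomp Require Import all_boot all_order all_algebra.
From mathcomp Require Import all_classical all_reals all_analysis.

Set Implicit Arguments.
Unset Strict Implicit.
Unset Printing Implicit Defensive.

Import Order.TTheory GRing.Theory Num.Theory.
Import numFieldNormedType.Exports.

Local Open Scope classical_set_scope.
Local Open Scope ring_scope.

(* A tensor of order N+1 has modes n : 'I_N.+1, so that the order is any
   integer >= 1; modes are cyclic, [ordS n] being the mode after n.  All indices
   start at 0, hence multi-indices are i_1 + i_2 I_1 + i_3 I_1 I_2 + ... *)
Section Modes.
Local Open Scope nat_scope.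
Variables (N : nat) (I : 'I_N.+1 -> nat).

Definition tensor_index : finType := {dffun forall k : 'I_N.+1, 'I_(I k)}.

Definition J (n : 'I_N.+1) : nat := (\prod_(k < N.+1 | k != n) I k)%N.

(* The modes n+1, ..., N, 1, ..., n-1 in this order. *)
Definition other_modes (n : 'I_N.+1) : seq 'I_N.+1 :=
  traject (@ordS N.+1) (ordS n) N.

(* The multi-index of (i_{n+1}, ..., i_N, i_1, ..., i_{n-1}). *)
Definition multi_index (n : 'I_N.+1) (a : forall k, 'I_(I k)) : nat :=
  foldr (fun k c => a k + I k * c)%N 0%N (other_modes n).

Hypothesis I_gt0 : forall k, (0 < I k)%N.

(* Inverse of [multi_index n] on the modes k != n (see [digitsK]); the value at
   k = n is irrelevant. *)
Definition digits (n : 'I_N.+1) (j : nat) (k : 'I_N.+1) : 'I_(I k) :=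
  let s := other_modes n in
  Ordinal (ltn_pmod (j %/ \prod_(l <- take (index k s) s) I l)%N (I_gt0 k)).

Lemma val_iter_ordS l (n : 'I_N.+1) :
  iter l (@ordS N.+1) n = (n + l) %% N.+1 :> nat.
Proof.
elim: l => [|l IH] /=; first by rewrite addn0 modn_small.
by rewrite IH -addn1 modnDml addn1 addnS.
Qed.

Lemma iter_ordS (n : 'I_N.+1) : iter N.+1 (@ordS N.+1) n = n.
Proof. by apply: ord_inj; rewrite val_iter_ordS modnDr modn_small.
Qed.

Lemma iter_ordS_pred (n : 'I_N.+1) : iter N (@ordS N.+1) (ordS n) = n.
Proof. by rewrite -iterSr iter_ordS. Qed.

Lemma other_modes_uniq (n : 'I_N.+1) : uniq (n :: other_modes n).
Proof.
rewrite (_ : n :: _ = traject (@ordS N.+1) n N.+1) //.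
apply/(uniqP n) => i j; rewrite !inE size_traject => ltiN ltjN.
rewrite !nth_traject // => /(congr1 (@nat_of_ord _)).
rewrite !val_iter_ordS => /eqP.
by rewrite eqn_modDl !modn_small // => /eqP.
Qed.

Lemma mem_other_modes (n k : 'I_N.+1) : (k \in other_modes n) = (k != n).
Proof.
have U := other_modes_uniq n.
have E : n :: other_modes n =i enum 'I_N.+1.
  have [] // := @uniq_min_size _ _ (enum 'I_N.+1) U.
  - by move=> x _; rewrite mem_enum.
  - by rewrite size_enum_ord /= size_traject.
have := E k; rewrite mem_enum inE /= => /esym.
case: eqVneq => [-> _ | //].
by case/andP: U => /negbTE.
Qed.

Lemma prod_other_modes (n : 'I_N.+1) : (\prod_(k <- other_modes n) I k)%N = J n.
Proof.
rewrite /J -[RHS]big_filter; apply: perm_big; apply: uniq_perm.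
- by case/andP: (other_modes_uniq n).
- by rewrite filter_uniq // index_enum_uniq.
by move=> k; rewrite mem_other_modes mem_filter mem_index_enum andbT.
Qed.

Lemma multi_index_lt (n : 'I_N.+1) (a : forall k, 'I_(I k)) :
  (multi_index n a < J n)%N.
Proof.
rewrite -prod_other_modes /multi_index; elim: other_modes => [|k s IH].
  by rewrite big_nil.
rewrite big_cons /=; apply: (@leq_trans
  (I k * (foldr (fun k c => a k + I k * c) 0 s).+1)%N).
  by rewrite mulnS ltn_add2r.
by rewrite leq_mul2l IH orbT.
Qed.

Lemma digitsK (n : 'I_N.+1) (a : forall k, 'I_(I k)) k :
  k != n -> digits n (multi_index n a) k = a k.
Proof.
rewrite -mem_other_modes => kin; apply: val_inj => /=.
rewrite /multi_index; elim: other_modes kin => //= l s IH.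
rewrite inE; case: eqVneq => [-> _ | _ /= kin].
  by rewrite big_nil divn1 addnC mulnC modnMDl modn_small.
by rewrite big_cons divnMA addnC mulnC divnMDl ?I_gt0 // (divn_small (ltn_ord (a l))) addn0 IH.
Qed.

End Modes.

Section TensorRing.
Variables (R : realType) (N : nat) (I rk : 'I_N.+1 -> nat).
Hypothesis I_gt0 : forall k, (0 < I k)%N.

Definition tensor := tensor_index I -> R.

(* [Y n i] is the lateral slice G_n(i) of the n-th core. *)
Definition cores := forall n : 'I_N.+1, 'I_(I n) -> 'M[R]_(rk n, rk (ordS n)).

(* G_n(a_n) G_{n+1}(a_{n+1}) ..., with l factors. *)
Fixpoint chain (Y : cores) (a : forall k, 'I_(I k)) (n : 'I_N.+1) (l : nat) :
    'M[R]_(rk n, rk (iter l (@ordS N.+1) n)) :=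
  match l with
  | 0 => 1%:M
  | l'.+1 => chain Y a n l' *m Y (iter l' (@ordS N.+1) n) (a _)
  end.

Definition TR (Y : cores) : tensor := fun a =>
  \tr (castmx (erefl, congr1 rk (iter_ordS ord0)) (chain Y a ord0 N.+1)).

(* The lateral slice number j of the subchain tensor. *)
Definition subchain (Y : cores) (n : 'I_N.+1) (j : 'I_(J I n)) :
    'M[R]_(rk (ordS n), rk n) :=
  castmx (erefl, congr1 rk (iter_ordS_pred n))
    (chain Y (digits I_gt0 n j) (ordS n) N).

Definition tensor_unfold (X : tensor) (n : 'I_N.+1) : 'M[R]_(I n, J I n) :=
  \matrix_(i < I n, j < J I n)
    X [ffun k : 'I_N.+1 =>
        @dfwith _ (fun k => 'I_(I k)) (digits I_gt0 n j) n i k : 'I_(I k)].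

Lemma tensor_unfoldE (X : tensor) (n : 'I_N.+1) (a : tensor_index I)
    (j : 'I_(J I n)) :
  j = multi_index n a :> nat -> tensor_unfold X n (a n) j = X a.
Proof.
move=> ja; rewrite mxE; congr X; apply/ffunP => k; rewrite ffunE.
have [->|kn] := eqVneq k n; first by rewrite dfwithin.
by rewrite dfwithout 1?eq_sym // ja digitsK.
Qed.

(* [mxvec] is row-major: for A : 'M_(m, n) the entry A i j is at position
   i * n + j.  So G_n(r, i, r') is in column r + r' * rk n of row i. *)
Definition core_unfold (Y : cores) (n : 'I_N.+1) :
    'M[R]_(I n, rk (ordS n) * rk n) :=
  \matrix_i mxvec (Y n i)^T.

Definition subchain_unfold (Y : cores) (n : 'I_N.+1) :
    'M[R]_(J I n, rk (ordS n) * rk n) :=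
  \matrix_j mxvec (subchain Y j).

(* Frobenius norm, which is the 2-norm on rows and columns. *)
Definition frob p q (A : 'M[R]_(p, q)) : R :=
  Num.sqrt (\sum_i \sum_j A i j ^+ 2).

Definition tensor_norm (T : tensor) : R := Num.sqrt (\sum_a T a ^+ 2).

Variable X : tensor.

Definition objective (Y : cores) : R :=
  2^-1 * tensor_norm (fun a => TR Y a - X a) ^+ 2.

(* The cores Y with the n-th one replaced by that whose unfolding is M. *)
Definition set_core (Y : cores) (n : 'I_N.+1)
    (M : 'M[R]_(I n, rk (ordS n) * rk n)) : cores :=
  @dfwith _ (fun k => 'I_(I k) -> 'M[R]_(rk k, rk (ordS k))) Y n
    (fun i => (vec_mx (row i M))^T).

(* Gradient of the objective with respect to the unfolding of the n-th core. *)
Definition grad (Y : cores) (n : 'I_N.+1) : 'M[R]_(I n, rk (ordS n) * rk n) :=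
  \matrix_(i, c) 'D_(delta_mx i c)
    (fun M => objective (set_core Y M) : R^o) (core_unfold Y n).

Definition residual (Y : cores) (n : 'I_N.+1) : 'M[R]_(I n, J I n) :=
  core_unfold Y n *m (subchain_unfold Y n)^T - tensor_unfold X n.

End TensorRing.

Definition is_distr (R : realType) (T : finType) (p : T -> R) : Prop :=
  (forall j, 0 <= p j <= 1) /\ \sum_j p j = 1.

Section Sampling.
Variables (R : realType) (N : nat) (I rk b : 'I_N.+1 -> nat).
Hypothesis I_gt0 : forall k, (0 < I k)%N.
Variable X : tensor R I.

(* The draws j_1, ..., j_{b n} when mode n is sampled. *)
Definition draws (n : 'I_N.+1) : finType := {ffun 'I_(b n) -> 'I_(J I n)}.

Definition stoch_grad (Y : cores R I rk) (n : 'I_N.+1) (p : 'I_(J I n) -> R)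
    (F : draws n) : 'M[R]_(I n, rk (ordS n) * rk n) :=
  let G := core_unfold Y n in
  let S := rowsub F (subchain_unfold I_gt0 Y n) in
  let D := diag_mx (\row_f (p (F f))^-1) in
  ((b n)%:R * (J I n)%:R)^-1 *:
    (G *m S^T *m D *m S - colsub F (tensor_unfold I_gt0 X n) *m D *m S).

(* The factor J_n compensates the 1/J_n in [stoch_grad], whose mean is 1/J_n
   times the gradient of [objective]. *)
Definition sq_error (Y : cores R I rk) (n : 'I_N.+1) (p : 'I_(J I n) -> R)
    (F : draws n) : R :=
  frob ((J I n)%:R *: stoch_grad Y p F - grad X Y n) ^+ 2.

(* Mean of [sq_error] when the draws are independent with law p. *)
Definition mean_sq_error (Y : cores R I rk) (n : 'I_N.+1)
    (p : 'I_(J I n) -> R) : R :=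
  \sum_(F : draws n) (\prod_f p (F f)) * sq_error Y p F.

Definition weight (Y : cores R I rk) (n : 'I_N.+1) (j : 'I_(J I n)) : R :=
  frob (col j (residual I_gt0 X Y n)) * frob (row j (subchain_unfold I_gt0 Y n)).

(* The condition under which the quotients (weight_j)^2 / p_j make sense, 0/0
   being read as 0. *)
Definition admissible (Y : cores R I rk) (n : 'I_N.+1)
    (p : 'I_(J I n) -> R) : Prop :=
  forall j, p j = 0 -> weight Y j = 0.

Section Process.
Variables (d : measure_display) (T : measurableType d) (P : probability T R).

Definition preimages (U : Type) (f : T -> U) : set (set T) :=
  [set f @^-1` B | B in setT].

Definition G_measurable (G : set (set T)) (f : T -> R) : Prop :=
  forall B : set R, measurable B -> G (f @^-1` B).

(* E is a version of the conditional expectation of Z given the sigma-algebra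
   G. *)
Definition is_cond_exp (G : set (set T)) (Z E : T -> R) : Prop :=
  [/\ P.-integrable setT (EFin \o Z),
      P.-integrable setT (EFin \o E),
      G_measurable G E
    & forall A, G A ->
        (\int[P]_(w in A) (E w)%:E = \int[P]_(w in A) (Z w)%:E)%E].

(* A value of zeta^t: the mode together with the draws made in this mode. *)
Definition sample : finType := {n : 'I_N.+1 & draws n}.

Variables (xi : nat -> T -> 'I_N.+1) (zeta : nat -> T -> sample).

(* The sigma-algebra generated by xi^0, zeta^0, ..., xi^{t-1}, zeta^{t-1}. *)
Definition history (t : nat) : set (set T) :=
  <<s \bigcup_(s in `I_t) (preimages (xi s) `|` preimages (zeta s)) >>.

(* The sigma-algebra generated by the same variables and xi^t. *)
Definition history_mode (t : nat) : set (set T) :=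
  <<s history t `|` preimages (xi t) >>.

(* Given [history_mode t], the sampled indices are independent with law
   q^{!= xi^t}. *)
Definition sampled_from (t : nat)
    (q : T -> forall n : 'I_N.+1, 'I_(J I n) -> R) : Prop :=
  forall k : sample, is_cond_exp (history_mode t)
    (\1_(zeta t @^-1` [set k]))
    (fun w => if tag k == xi t w
              then \prod_f q w (tag k) (tagged k f) else 0).

End Process.
End Sampling.

(* Main.v *)
(* Padding every slice to one common square size turns the trace defining a
   tensor ring into a cyclically invariant product, so X_[n] of the tensor ring
   is G_{n(2)} S^T with S the unfolded subchain and the gradient is R S, with R
   the residual.  Hence J_n times the stochastic gradient is the mean of |F_n|
   independent copies of the rank-one matrix R(:, j) S(j, :) / p_j, whose
   expectation is the gradient; its variance is 1 / |F_n| times that of a single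
   copy.  The minimisation over p is the Cauchy-Schwarz inequality.

   All random variables generating the conditioning sigma-algebra take finitely
   many values.  So this sigma-algebra consists of the preimages under a single
   map into a finite type, and a measurable function is one that is constant on
   the fibers of this map; it can be pulled out of a conditional expectation as
   a finite combination of indicators, without any bound on the iterates. *)

Require Import Defs.
From mathcomp Require Import all_boot all_order all_algebra.
From mathcomp Require Import all_classical all_reals all_analysis.
From mathcomp Require Import ring.

Set Implicit Arguments.
Unset Strict Implicit.
Unset Printing Implicit Defensive.

Import Order.TTheory GRing.Theory Num.Theory.
Import numFieldNormedType.Exports.

Local Open Scope classical_set_scope.
Local Open Scope ring_scope.

(** * Frobenius norm and directional derivatives *)

Lemma frob_sqr (R : realType) p k (A : 'M[R]_(p, k)) :
  frob A ^+ 2 = \sum_i \sum_j A i j ^+ 2.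
Proof.
rewrite sqr_sqrtr //; apply: sumr_ge0 => i _; apply: sumr_ge0 => j _.
exact: sqr_ge0.
Qed.

Lemma frob_eq0 (R : realType) m k (B : 'M[R]_(m, k)) i j :
  frob B = 0 -> B i j = 0.
Proof.
move=> /eqP; rewrite -sqrf_eq0 frob_sqr pair_bigA /= psumr_eq0 => [|l _];
  last exact: sqr_ge0.
by move=> /allP /(_ (i, j)); rewrite mem_index_enum sqrf_eq0 => /(_ isT) /eqP.
Qed.

(** For nonzero h the difference quotient is l + h c, which tends to l. The objective has this form
    along each entry of a core. *)
Lemma derive_quadratic (R : realType) (V : normedModType R) (f : V -> R^o)
    (v a : V) (l c : R) :
  (forall h : R, f (h *: v + a) = f a + h * l + h ^+ 2 * c) -> 'D_v f a = l.
Proof.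
move=> E; rewrite /derive; apply: cvg_lim => //=.
apply: (@cvg_trans _ ((fun h : R => l + h * c) @ 0^')).
  apply: near_eq_cvg; near=> h.
  have h0 : h != 0 by near: h; exact: nbhs_dnbhs_neq.
  rewrite E [X in _ *: X]addrC !addrA addNr add0r expr2 -mulrA -mulrDr.
  by rewrite -[RHS]/(_ * _) mulKf.
have : (fun h : R => l + h * c) @ 0^' --> l + 0 * c.
  apply: cvgD; first exact: cvg_cst.
  by apply: cvgM; [exact: nbhs_dnbhs | exact: cvg_cst].
by rewrite mul0r addr0.
Unshelve. all: by end_near. Qed.

(** * Padding matrices to a common square size *)

Section Padding.
Variables (R : comNzRingType) (K : nat).

(** For m, n <= K + 1 this is A in the upper left corner of a zero matrix. The size [K.+1] is
    positive, so the padded matrices form a ring and iterated products are available. *)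
Definition pad m n (A : 'M[R]_(m, n)) : 'M[R]_K.+1 :=
  pid_mx m *m A *m pid_mx n.

Lemma pid_mx_narrow m : (m <= K.+1)%N ->
  (pid_mx m : 'M[R]_(m, K.+1)) *m (pid_mx m : 'M[R]_(K.+1, m)) = 1%:M.
Proof. by move=> mK; rewrite pid_mx_id // pid_mx_1. Qed.

Lemma pad_mul m n p (A : 'M[R]_(m, n)) (B : 'M[R]_(n, p)) :
  (n <= K.+1)%N -> pad (A *m B) = pad A * pad B.
Proof.
move=> nK; rewrite /pad -[RHS]/(_ *m _) !mulmxA.
by rewrite -[_ *m pid_mx n *m pid_mx n]mulmxA pid_mx_narrow // mulmx1.
Qed.

Lemma mxtrace_pad n (A : 'M[R]_n) : (n <= K.+1)%N -> \tr (pad A) = \tr A.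
Proof. by move=> nK; rewrite mxtrace_mulC mulmxA pid_mx_narrow // mul1mx. Qed.

Lemma pad_castmx m n n' (e : n = n') (A : 'M[R]_(m, n)) :
  pad (castmx (erefl, e) A) = pad A.
Proof. by case: n' / e; rewrite castmx_id. Qed.

Lemma mxtrace_prod_rot (T : Type) (B : T -> 'M[R]_K.+1) l s :
  \tr (\prod_(k <- rot l s) B k) = \tr (\prod_(k <- s) B k).
Proof.
by rewrite -[in RHS](cat_take_drop l s) /rot !big_cat -mxtrace_mulC.
Qed.

End Padding.

(** * Unfoldings and the gradient *)

Section Unfolding.
Variables (R : realType) (N : nat) (I rk : 'I_N.+1 -> nat).
Hypothesis I_gt0 : forall k, (0 < I k)%N.
Implicit Types (Y : cores R I rk) (n : 'I_N.+1).

Let K := \max_k rk k.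

Let rkK k : (rk k <= K.+1)%N.
Proof. by rewrite ltnW // ltnS leq_bigmax. Qed.

(** The factor A starts the product because the identity of size [rk n] pads to a proper projection,
    not to the unit. *)
Lemma pad_mul_chain Y (a : forall k, 'I_(I k)) n l m (A : 'M[R]_(m, rk n)) :
  pad K (A *m chain Y a n l) =
  pad K A * \prod_(k <- traject (@ordS N.+1) n l) pad K (Y k (a k)).
Proof.
elim: l => [|l IH]; first by rewrite mulmx1 big_nil mulr1.
by rewrite mulmxA pad_mul // IH trajectSr -cats1 big_cat big_seq1 mulrA.
Qed.

(** Any mode may open the cyclic product. The dependent sizes obstruct rotating the chain itself, so
    the trace is first moved to padded factors. *)
Lemma mxtrace_chain_cycle Y (a : tensor_index I) n :
  TR Y a = \tr (Y n (a n) *m castmx (erefl, congr1 rk (iter_ordS_pred n))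
                                  (chain Y a (ordS n) N)).
Proof.
pose B k := pad K (Y k (a k)).
have ->: TR Y a = \tr (\prod_(k <- traject (@ordS N.+1) ord0 N.+1) B k).
  (* The identity inserted here serves as the factor A of [pad_mul_chain]; it is then merged into
     the first core. *)
  rewrite /TR -(mxtrace_pad _ (rkK _)) pad_castmx -[chain _ _ _ _]mul1mx.
  by rewrite pad_mul_chain trajectS big_cons mulrA -pad_mul // mul1mx.
rewrite -(mxtrace_pad _ (rkK _)) pad_mul // pad_castmx -pad_mul //.
rewrite pad_mul_chain.
rewrite (_ : _ * _ = \prod_(k <- traject (@ordS N.+1) n N.+1) B k); last first.
  by rewrite trajectS big_cons.
(* The modes in the order n, n+1, ... are the rotation by n of 0, 1, ..., N. *)
rewrite -[LHS](mxtrace_prod_rot _ n); congr (\tr _); congr (\prod_(k <- _) _).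
apply: (@eq_from_nth _ ord0); rewrite ?size_rot ?size_traject // => i iN.
have nthT x m : (m < N.+1)%N ->
    nth ord0 (traject (@ordS N.+1) x N.+1) m = ((x + m) %% N.+1)%N :> nat.
  move=> mN; rewrite (set_nth_default x) ?size_traject // nth_traject //.
  exact: val_iter_ordS.
have nN : (n <= N.+1)%N by apply: ltnW.
apply: ord_inj; rewrite nthT // nth_cat size_drop size_traject.
case: ltnP => ni; first by rewrite nth_drop nthT ?add0n // -ltn_subRL.
rewrite nth_take ?nthT ?add0n; first last.
- by rewrite ltn_subLR // subnK.
- by rewrite (leq_ltn_trans (leq_subr _ _)).
(* Past the wraparound the two positions differ by one full turn of N + 1 modes. *)
have -> : (n + i = (i - (N.+1 - n)) + N.+1)%N.
  by rewrite -[in LHS](subnK ni) addnCA subnKC.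
by rewrite modnDr.
Qed.

(** The subchain skips mode n, so this frees both the index at mode n and the n-th core. *)
Lemma eq_chain Y Y' (a a' : forall k, 'I_(I k)) n l :
  (forall k, k \in traject (@ordS N.+1) n l -> Y k (a k) = Y' k (a' k)) ->
  chain Y a n l = chain Y' a' n l.
Proof.
elim: l => // l IH E.
rewrite [LHS]/= IH ?E // ?trajectSr ?mem_rcons ?mem_head //.
by move=> k kl; apply: E; rewrite trajectSr mem_rcons inE kl orbT.
Qed.

(** With the core transposed, both unfoldings list their columns with r' as the outer index, so the
    product of rows is the double sum of the trace. *)
Lemma core_subchainE Y n i j :
  (core_unfold Y n *m (subchain_unfold I_gt0 Y n)^T) i j =
  \tr (Y n i *m subchain I_gt0 Y j).
Proof.
rewrite mxE /mxtrace.
under [RHS]eq_bigr do rewrite mxE.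
rewrite exchange_big pair_big /= (reindex _ (curry_mxvec_bij _ _)) /=.
by apply: eq_bigr => -[r' r] _ /=; rewrite !mxE /= !mxvecE mxE.
Qed.

Lemma tensor_unfold_TR Y n :
  tensor_unfold I_gt0 (TR Y) n =
  core_unfold Y n *m (subchain_unfold I_gt0 Y n)^T.
Proof.
apply/matrixP => i j; rewrite core_subchainE mxE.
rewrite (mxtrace_chain_cycle _ _ n) ffunE dfwithin.
congr (\tr (_ *m castmx _ _)); apply: eq_chain => k.
rewrite -/(other_modes n) mem_other_modes eq_sym => kn.
by rewrite ffunE dfwithout.
Qed.

Definition fiber_index n (a : tensor_index I) : 'I_(I n) * 'I_(J I n) :=
  (a n, Ordinal (multi_index_lt n a)).

(** Injective since [digits] recovers the indices at the modes other than n; both sides have I_n J_n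
    elements. *)
Lemma fiber_index_bij n : bijective (@fiber_index n).
Proof.
apply: inj_card_bij => [a a' [an E]|].
  apply/ffunP => k; have [->//|kn] := eqVneq k n.
  by rewrite -(digitsK I_gt0 a kn) E digitsK.
rewrite card_prod !card_ord card_dep_ffun foldrE big_map big_enum /=.
rewrite (bigD1 n) //= card_ord /J leq_mul2l; apply/orP; right.
by apply/eq_leq/eq_bigr => k _; rewrite card_ord.
Qed.

Lemma tensor_norm_unfold (T : tensor R I) n :
  tensor_norm T = frob (tensor_unfold I_gt0 T n).
Proof.
rewrite /tensor_norm /frob pair_bigA /= (reindex (@fiber_index n)) /=.
  by congr Num.sqrt; apply: eq_bigr => a _; rewrite /= tensor_unfoldE.
by apply: onW_bij; apply: fiber_index_bij.
Qed.

Variable X : tensor R I.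

Lemma objective_residual Y n :
  objective X Y = 2^-1 * frob (residual I_gt0 X Y n) ^+ 2.
Proof.
rewrite /objective (tensor_norm_unfold _ n) /residual -tensor_unfold_TR.
by congr (_ * frob _ ^+ 2); apply/matrixP => i j; rewrite !mxE.
Qed.

Lemma core_unfold_set_core Y n M : core_unfold (@set_core _ _ _ _ Y n M) n = M.
Proof.
by apply/row_matrixP => i; rewrite rowK /set_core dfwithin trmxK vec_mxK.
Qed.

(** The residual is therefore affine in the n-th core. *)
Lemma subchain_unfold_set_core Y n M :
  subchain_unfold I_gt0 (@set_core _ _ _ _ Y n M) n = subchain_unfold I_gt0 Y n.
Proof.
apply/row_matrixP => j; rewrite !rowK /subchain.
congr (mxvec (castmx _ _)); apply: eq_chain => k.
rewrite -/(other_modes n) mem_other_modes eq_sym => kn.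
by rewrite /set_core dfwithout.
Qed.

(** Adding h times [delta_mx i c] to the core moves the residual A to A + h B with B =
    [delta_mx i c *m S^T], so the derivative is the inner product of A and B. *)
Lemma gradE Y n :
  grad X Y n = residual I_gt0 X Y n *m subchain_unfold I_gt0 Y n.
Proof.
apply/matrixP => i c; rewrite mxE.
set S := subchain_unfold _ _ _; set A := residual _ _ _ _.
pose B : 'M[R]_(_, _) := delta_mx i c *m S^T.
rewrite (@derive_quadratic _ _ _ _ _ (\sum_i \sum_j A i j * B i j)
  (2^-1 * frob B ^+ 2)).
  (* B lives on row i, where it is column c of S. *)
  rewrite mxE (bigD1 i) //= [X in _ + X]big1 ?addr0.
    apply: eq_bigr => j _; congr (_ * _); rewrite mxE (bigD1 c) //= big1 ?addr0.
      by rewrite !mxE !eqxx mul1r.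
    by move=> k kc; rewrite !mxE (negbTE kc) andbF mul0r.
  move=> k ki; rewrite big1 // => j _.
  rewrite [B _ _]mxE big1 ?mulr0 // => c' _.
  by rewrite mxE (negbTE ki) mul0r.
move=> h; rewrite !(objective_residual _ n) /residual !core_unfold_set_core.
rewrite !subchain_unfold_set_core -/S mulmxDl -scalemxAl -/B -addrA -/A.
rewrite !frob_sqr !pair_bigA !mulr_sumr -!big_split.
apply: eq_bigr => -[i' j] _ /=.
rewrite mxE [(h *: B) _ _]mxE; by field.
Qed.

End Unfolding.

(** * Variance of a sample mean *)

Section SampleMean.
Variables (R : realFieldType) (T : finType) (p : T -> R).
Hypothesis p_sum : \sum_j p j = 1.

(** Independence of the draws, as distributivity of the product over sums. *)
Lemma mean_prod (B : finType) (h : B -> T -> R) :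
  \sum_(F : {ffun B -> T}) (\prod_f p (F f)) * \prod_f h f (F f) =
  \prod_f \sum_j p j * h f j.
Proof.
by rewrite bigA_distr_bigA; apply: eq_bigr => F _; rewrite big_split.
Qed.

Lemma covariance_draws (B : finType) (c : T -> R) (f f' : B) :
  \sum_j p j * c j = 0 ->
  \sum_(F : {ffun B -> T}) (\prod_g p (F g)) * (c (F f) * c (F f')) =
  if f' == f then \sum_j p j * c j ^+ 2 else 0.
Proof.
(* The value 1 off e makes [c (F e)] a product over all draws. When f' differs from f, the factor at
   f is the zero mean of c. *)
move=> c0; pose h (e g : B) j := if g == e then c j else 1.
have hE (F : {ffun B -> T}) e : c (F e) = \prod_g h e g (F g).
  by rewrite -big_mkcond big_pred1_eq.
under eq_bigr do rewrite (hE _ f) (hE _ f') -big_split /=.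
rewrite (mean_prod (fun g j => h f g j * h f' g j)) (bigD1 f) //= /h eqxx.
case: (eqVneq f' f) => [->|ne]; last first.
  by under eq_bigr do rewrite mulr1; rewrite c0 mul0r.
rewrite [X in _ * X]big1 ?mulr1 => [|g /negbTE ->].
  by under eq_bigr do rewrite -expr2.
by under eq_bigr do rewrite !mulr1.
Qed.

(** After centring and expanding the square, only the b diagonal terms survive, each with the factor
    1 / b^2. *)
Lemma variance_sample_mean (b : nat) (u : T -> R) (m : R) :
  (0 < b)%N -> \sum_j p j * u j = m ->
  \sum_(F : {ffun 'I_b -> T}) (\prod_f p (F f)) *
    (b%:R^-1 * \sum_f u (F f) - m) ^+ 2 =
  b%:R^-1 * (\sum_j p j * u j ^+ 2 - m ^+ 2).
Proof.
move=> b0 um; pose c j := u j - m.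
have bn0 : b%:R != 0 :> R by rewrite pnatr_eq0 -lt0n.
have c0 : \sum_j p j * c j = 0.
  under eq_bigr do rewrite mulrBr.
  by rewrite sumrB um -mulr_suml p_sum mul1r subrr.
have c2 : \sum_j p j * c j ^+ 2 = \sum_j p j * u j ^+ 2 - m ^+ 2.
  transitivity (\sum_j (p j * u j ^+ 2 - (p j * u j * (2 * m) - p j * m ^+ 2))).
    by apply: eq_bigr => j _; rewrite /c; ring.
  by rewrite !sumrB -!mulr_suml um p_sum; ring.
transitivity (\sum_(F : {ffun 'I_b -> T}) \sum_f \sum_f' b%:R^-2 *
    ((\prod_g p (F g)) * (c (F f) * c (F f')))).
  apply: eq_bigr => F _.
  have -> : b%:R^-1 * \sum_f u (F f) - m = b%:R^-1 * \sum_f c (F f).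
    rewrite sumrB sumr_const card_ord mulrBr; congr (_ - _).
    by rewrite -mulr_natr; field.
  rewrite exprMn -exprVn [X in _ * (_ * X)]expr2 big_distrlr /= !mulr_sumr.
  apply: eq_bigr => f _; rewrite !mulr_sumr; apply: eq_bigr => f' _.
  by rewrite mulrCA.
rewrite exchange_big /=; under eq_bigr do rewrite exchange_big /=.
under eq_bigr => f _.
  under eq_bigr => f' _ do rewrite -mulr_sumr covariance_draws // c2.
  rewrite -mulr_sumr -big_mkcond /= big_pred1_eq; over.
by rewrite sumr_const card_ord -mulr_natr; field.
Qed.

End SampleMean.

(** * Mean squared error for a fixed iterate and mode *)

Section MeanSquaredError.
Variables (R : realType) (N : nat) (I rk b : 'I_N.+1 -> nat).
Hypothesis I_gt0 : forall k, (0 < I k)%N.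
Hypothesis b_gt0 : forall k, (0 < b k)%N.
Variables (X : tensor R I) (Y : cores R I rk) (n : 'I_N.+1).
Implicit Type p : 'I_(J I n) -> R.

Local Notation S := (subchain_unfold I_gt0 Y n).
Local Notation A := (residual I_gt0 X Y n).
Local Notation w := (weight I_gt0 X Y (n := n)).

(** The two terms of [stoch_grad] share the right factor D S, so their difference exhibits the
    sampled columns of the residual; J_n cancels. *)
Lemma stoch_gradE p (F : draws I b n) i c :
  ((J I n)%:R *: stoch_grad I_gt0 X Y p F) i c =
  (b n)%:R^-1 * \sum_f A i (F f) * (p (F f))^-1 * S (F f) c.
Proof.
have J0 : (J I n)%:R != 0 :> R by rewrite pnatr_eq0 -lt0n prodn_gt0.
have b0 : (b n)%:R != 0 :> R by rewrite pnatr_eq0 -lt0n.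
rewrite /stoch_grad scalerA invfM mulrCA divff // mulr1 mxE; congr (_ * _).
rewrite -!mulmxBl mxE; apply: eq_bigr => f _; rewrite [rowsub _ _ _ _]mxE.
congr (_ * _); rewrite mul_mx_diag mxE [(\row__ _) _ _]mxE; congr (_ * _).
rewrite !mxE; congr (_ - _); apply: eq_bigr => k _.
by rewrite !mxE.
Qed.

(** Handles the indices with p j = 0, where admissibility forces the weight to vanish. *)
Lemma weight0_entries j i c : w j = 0 -> A i j * S j c = 0.
Proof.
move=> /eqP; rewrite mulf_eq0 => /orP[] /eqP /frob_eq0.
  by move=> /(_ i ord0); rewrite mxE => ->; rewrite mul0r.
by move=> /(_ ord0 c); rewrite mxE => ->; rewrite mulr0.
Qed.

(** The scalar variance identity is applied to every entry (i, c) and the results are summed. *)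
Lemma mean_sq_errorE p : \sum_j p j = 1 -> admissible I_gt0 X Y p ->
  mean_sq_error b I_gt0 X Y p =
  (b n)%:R^-1 * \sum_j (p j)^-1 * w j ^+ 2
  - (b n)%:R^-1 * frob (grad X Y n) ^+ 2.
Proof.
move=> p1 adm; pose u i c j := A i j * (p j)^-1 * S j c.
(* Unbiasedness: p j cancels, and a term with p j = 0 is already zero in the gradient. *)
have um i c : \sum_j p j * u i c j = grad X Y n i c.
  rewrite (gradE I_gt0) mxE; apply: eq_bigr => j _; rewrite /u.
  have [p0|p0] := eqVneq (p j) 0; last by field.
  by rewrite p0 mul0r weight0_entries // adm.
transitivity (\sum_i \sum_c \sum_(F : draws I b n) (\prod_f p (F f)) *
    ((b n)%:R^-1 * \sum_f u i c (F f) - grad X Y n i c) ^+ 2).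
  under [RHS]eq_bigr do rewrite exchange_big /=.
  rewrite exchange_big; apply: eq_bigr => F _ /=.
  rewrite /sq_error frob_sqr mulr_sumr; apply: eq_bigr => i _.
  rewrite mulr_sumr; apply: eq_bigr => c _.
  by rewrite mxE stoch_gradE [X in _ + X]mxE.
under eq_bigr do under eq_bigr do rewrite (variance_sample_mean p1) //.
rewrite -mulrBr frob_sqr; under eq_bigr do rewrite -mulr_sumr.
rewrite -mulr_sumr; congr (_ * _).
under eq_bigr do rewrite sumrB; rewrite sumrB; congr (_ - _).
under eq_bigr do rewrite exchange_big /=.
rewrite exchange_big; apply: eq_bigr => j _ /=.
(* The squared norm of a rank-one matrix is the product of the squared norms of its factors. *)
rewrite /weight exprMn !frob_sqr big_ord1 mulr_suml mulr_sumr.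
apply: eq_bigr => i _; rewrite big_ord1 !mulr_sumr; apply: eq_bigr => c _.
rewrite /u !mxE; have [->|p0] := eqVneq (p j) 0; last by field.
by rewrite invr0 !mul0r.
Qed.

(** Cauchy-Schwarz, as nonnegativity of the variance of w j / p j under p; the mean is the total
    weight W by admissibility. *)
Lemma sqr_sum_weight_le p : is_distr p -> admissible I_gt0 X Y p ->
  (\sum_j w j) ^+ 2 <= \sum_j (p j)^-1 * w j ^+ 2.
Proof.
move=> [p01 p1] adm; set W := \sum_j w j.
have : 0 <= \sum_j p j * ((p j)^-1 * w j - W) ^+ 2.
  by apply: sumr_ge0 => j _; rewrite mulr_ge0 ?sqr_ge0 //; case/andP: (p01 j).
suff -> : \sum_j p j * ((p j)^-1 * w j - W) ^+ 2 =
          \sum_j (p j)^-1 * w j ^+ 2 - W ^+ 2 by rewrite subr_ge0.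
transitivity (\sum_j ((p j)^-1 * w j ^+ 2 - (w j * (2 * W) - p j * W ^+ 2))).
  apply: eq_bigr => j _; have [p0|p0] := eqVneq (p j) 0; last by field.
  by rewrite p0 adm // invr0; ring.
by rewrite !sumrB -!mulr_suml p1 -/W; ring.
Qed.

(** Since x / 0 = 0, a zero total would make p vanish identically. *)
Lemma sum_weight_neq0 p : is_distr p ->
  (forall j, p j = w j / \sum_j' w j') -> \sum_j w j != 0.
Proof.
move=> [_ p1] pw; apply/eqP => W0; move: p1.
rewrite big1 => [/eqP|j _]; first by rewrite eq_sym oner_eq0.
by rewrite pw W0 invr0 mulr0.
Qed.

Lemma optimal_admissible p : is_distr p ->
  (forall j, p j = w j / \sum_j' w j') -> admissible I_gt0 X Y p.
Proof.
move=> pd pw j /eqP; rewrite pw mulf_eq0 invr_eq0.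
by rewrite (negbTE (sum_weight_neq0 pd pw)) orbF => /eqP.
Qed.

(** Equality case of Cauchy-Schwarz: each summand is w j times the total weight. *)
Lemma optimal_sum p : is_distr p ->
  (forall j, p j = w j / \sum_j' w j') ->
  \sum_j (p j)^-1 * w j ^+ 2 = (\sum_j w j) ^+ 2.
Proof.
move=> pd pw; rewrite expr2 mulr_sumr; apply: eq_bigr => j _; rewrite pw.
have W0 := sum_weight_neq0 pd pw.
have [->|w0] := eqVneq (w j) 0; first by rewrite expr0n !mulr0.
by field; rewrite W0 w0.
Qed.

End MeanSquaredError.

(** * Conditioning on finitely many values *)

Section FiniteConditioning.
Variables (R : realType) (d : measure_display) (T : measurableType d).
Variables (P : probability T R) (V : finType) (H : T -> V).

(** One direction pulls back the singleton of a value. In the other, a set pulled back by f is a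
    union of fibers of H, hence the preimage of its image. *)
Lemma G_measurable_preimages (f : T -> R) :
  G_measurable (preimages H) f <-> forall w w', H w = H w' -> f w = f w'.
Proof.
split=> [mf w w' Hw|Hf B _].
  have [B _ HB] := mf [set f w'] (measurable_set1 _).
  have : (H @^-1` B) w' by rewrite HB.
  by rewrite /preimage /= -Hw -[B _]/((H @^-1` B) w) HB.
exists (H @` (f @^-1` B)) => //; apply/seteqP; split=> w /=.
  by move=> [w' Bw' /Hf <-].
by move=> Bw; exists w.
Qed.

Lemma sigma_algebra_preimages : sigma_algebra setT (preimages H).
Proof.
split.
- by exists set0.
- by move=> _ [B _ <-]; exists (~` B) => //; rewrite setTD preimage_setC.
move=> F mF; pose B := [set v | exists i w, F i w /\ H w = v].
exists B => //; apply/seteqP; split=> w /=.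
  move=> [i [w' [Fw' Hw]]]; exists i => //.
  by have [C _ FC] := mF i; move: Fw'; rewrite -FC /preimage /= Hw.
by move=> [i _ Fw]; exists i, w.
Qed.

Hypothesis mH : forall A, preimages H A -> measurable A.

Lemma is_cond_exp_sum (K : finType) (Z E : K -> T -> R) :
  (forall k, is_cond_exp P (preimages H) (Z k) (E k)) ->
  is_cond_exp P (preimages H) (fun w => \sum_k Z k w) (fun w => \sum_k E k w).
Proof.
move=> ZE.
have EFin_sum (f : K -> T -> R) :
    EFin \o (fun w => \sum_k f k w) = fun w => (\sum_k (EFin \o f k) w)%E.
  by apply/funext => w /=; rewrite sumEFin.
split.
- by rewrite EFin_sum; apply: integrable_sum => // k _; case: (ZE k).
- by rewrite EFin_sum; apply: integrable_sum => // k _; case: (ZE k).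
- apply/G_measurable_preimages => w w' Hw; apply: eq_bigr => k _.
  by case: (ZE k) => _ _ /G_measurable_preimages /(_ w w' Hw).
move=> A GA; have mA := mH GA.
have sumE (f : K -> T -> R) : (forall k, P.-integrable setT (EFin \o f k)) ->
    (\int[P]_(w in A) (\sum_k f k w)%:E = \sum_k \int[P]_(w in A) (f k w)%:E)%E.
  move=> fi; under eq_integral do rewrite -sumEFin.
  rewrite integral_sum // => k.
  by apply: integrableS (fi k).
rewrite !sumE => [||k]; try by case: (ZE k).
  by apply: eq_bigr => k _; case: (ZE k) => _ _ _ /(_ A GA).
by move=> k; case: (ZE k).
Qed.

(** Restriction to B turns an integral over A into one over the intersection of A and B, again a
    preimage under H. *)
Lemma is_cond_exp_scale_indic (B : set T) (c : R) (Z E : T -> R) :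
  preimages H B -> is_cond_exp P (preimages H) Z E ->
  is_cond_exp P (preimages H) (fun w => c * (Z \_ B) w)
    (fun w => c * (E \_ B) w).
Proof.
move=> GB [Zi Ei mE ZE]; have mB := mH GB.
have patchE (f : T -> R) w : ((f \_ B) w)%:E = ((EFin \o f) \_ B) w.
  by rewrite /patch; case: ifP.
have patch_int (f : T -> R) : P.-integrable setT (EFin \o f) ->
    P.-integrable setT ((EFin \o f) \_ B).
  by move=> fi; rewrite -integrable_mkcond //; apply: integrableS fi.
have scale_int (f : T -> R) : P.-integrable setT (EFin \o f) ->
    P.-integrable setT (EFin \o (fun w => c * (f \_ B) w)).
  move=> /patch_int fi.
  apply: eq_integrable (integrableZl measurableT c fi) => //.
  by move=> w _ /=; rewrite EFinM patchE.
split; [exact: scale_int | exact: scale_int | |].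
  apply/G_measurable_preimages => w w' Hw; congr (_ * _); rewrite /patch.
  have -> : (w \in B) = (w' \in B).
    by have [C _ <-] := GB; rewrite -[LHS]/(H w \in C) Hw.
  by move/G_measurable_preimages: mE => /(_ w w' Hw) ->.
move=> A GA; have mA := mH GA.
have scaleE (f : T -> R) : P.-integrable setT (EFin \o f) ->
    (\int[P]_(w in A) (c * (f \_ B) w)%:E =
     c%:E * \int[P]_(w in A `&` B) (f w)%:E)%E.
  move=> /patch_int fi; rewrite integral_mkcondr -integralZl //; last first.
    by apply: integrableS fi.
  by apply: eq_integral => w _; rewrite EFinM patchE.
rewrite !scaleE // ZE //.
have [C _ <-] := GA; have [D _ <-] := GB; exists (C `&` D) => //.
Qed.

Lemma is_cond_exp_pull_out (g Z E : T -> R) :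
  (forall w w', H w = H w' -> g w = g w') ->
  is_cond_exp P (preimages H) Z E ->
  is_cond_exp P (preimages H) (fun w => g w * Z w) (fun w => g w * E w).
Proof.
move=> Hg ZE.
(* The value of g on the fiber of v, read off at a chosen point; on an empty fiber it is a default
   that the restriction kills. *)
pose c v := g (xget point (H @^-1` [set v])).
have gE (f : T -> R) :
    (fun w => g w * f w) =
    fun w => \sum_v c v * (f \_ (H @^-1` [set v])) w.
  apply/funext => w; rewrite (bigD1 (H w)) //= big1 ?addr0 => [|v vw].
    rewrite patchE ifT ?inE //; congr (_ * _); apply: Hg.
    by rewrite /c; case: xgetP => [//|/(_ w) []].
  rewrite patchE ifF ?mulr0 //; apply/negP; rewrite inE /= => wv.
  by rewrite wv eqxx in vw.
rewrite !gE; apply: is_cond_exp_sum => v; apply: is_cond_exp_scale_indic => //.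
by exists [set v].
Qed.

End FiniteConditioning.

(** * The history as a single map into a finite type *)

Section History.
Variables (N : nat) (I b : 'I_N.+1 -> nat).
Variables (d : measure_display) (T : measurableType d).
Variables (xi : nat -> T -> 'I_N.+1) (zeta : nat -> T -> sample I b).

Definition past t : finType :=
  ({ffun 'I_t -> 'I_N.+1 * sample I b} * 'I_N.+1)%type.

Definition past_of t (w : T) : past t :=
  ([ffun s : 'I_t => (xi s w, zeta s w)], xi t w).

Lemma history_sub_mode t : history xi zeta t `<=` history_mode xi zeta t.
Proof. by move=> A hA; apply: sub_sigma_algebra; left. Qed.

(** Each generator reads one coordinate of [past_of]. Conversely a preimage is a finite union of
    fibers, and a fiber is a finite intersection of generators. *)
Lemma history_modeE t : history_mode xi zeta t = preimages (past_of t).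
Proof.
apply/seteqP; split.
  apply: smallest_sub; first exact: sigma_algebra_preimages.
  move=> A [|[B _ <-]]; last by exists [set v : past t | B v.2].
  move: A; apply: smallest_sub; first exact: sigma_algebra_preimages.
  move=> A [s /= st] [[B _ <-]|[B _ <-]].
    exists [set v : past t | B (v.1 (Ordinal st)).1] => //.
    by apply/seteqP; split=> w; rewrite /preimage /= ffunE.
  exists [set v : past t | B (v.1 (Ordinal st)).2] => //.
  by apply/seteqP; split=> w; rewrite /preimage /= ffunE.
move=> _ [B _ <-].
pose G := history xi zeta t `|` preimages (xi t).
rewrite -[history_mode _ _ _ _]/(@measurable _ (g_sigma_algebraType G) _).
have -> : past_of t @^-1` B = \bigcup_(v in B) past_of t @^-1` [set v].
  apply/seteqP; split=> [w Bw|w [v Bv /= wv]].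
    by exists (past_of t w).
  by rewrite /preimage /= wv.
apply: fin_bigcup_measurable => [|v _]; first exact: finite_finset.
have -> : past_of t @^-1` [set v] =
    (\bigcap_(s in [set: 'I_t])
       (xi s @^-1` [set (v.1 s).1] `&` zeta s @^-1` [set (v.1 s).2]))
    `&` xi t @^-1` [set v.2].
  apply/seteqP; split=> [w <-|w [/= vs vt]].
    by split=> // s _; rewrite /= ffunE.
  case: v vs vt => v1 v2 /= vs vt; rewrite /past_of vt; congr (_, _).
  apply/ffunP => s; rewrite ffunE; have [-> ->] := vs s Logic.I.
  by case: (v1 s).
have mG A : history xi zeta t A -> @measurable _ (g_sigma_algebraType G) A.
  exact: history_sub_mode.
apply: measurableI.
  apply: fin_bigcap_measurable => [|s _]; first exact: finite_finset.
  apply: measurableI; apply: mG; apply: sub_sigma_algebra;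
    exists (val s) => //=.
    by left; exists [set (v.1 s).1].
  by right; exists [set (v.1 s).2].
by apply: sub_sigma_algebra; right; exists [set v.2].
Qed.

Lemma history_mode_measurable t :
  (forall s A, preimages (xi s) A -> measurable A) ->
  (forall s A, preimages (zeta s) A -> measurable A) ->
  forall A, history_mode xi zeta t A -> measurable A.
Proof.
move=> mxi mzeta; apply: smallest_sub; first exact: sigma_algebra_measurable.
move=> A [|/mxi//]; move: A.
apply: smallest_sub; first exact: sigma_algebra_measurable.
by move=> A [s _] [/mxi|/mzeta].
Qed.

End History.

(** Turns a sum over samples in the current mode into the sum over draws that defines
    [mean_sq_error]. *)
Lemma sum_sample (R : nmodType) (N : nat) (I b : 'I_N.+1 -> nat)
    (n : 'I_N.+1) (f : sample I b -> R) :
  \sum_(k : sample I b | tag k == n) f k =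
  \sum_(F : draws I b n) f (Tagged (draws I b) F).
Proof.
transitivity
  (\sum_(m | m == n) \sum_(F : draws I b m) f (Tagged (draws I b) F));
  last first.
  by rewrite big_pred1_eq.
by rewrite sig_big_dep; apply: eq_big => [k|[m F] _] //=; rewrite andbT.
Qed.

(** * Conditional mean of the squared error and its minimum *)

Theorem theorem3p2 (R : realType) (N : nat) (I rk b : 'I_N.+1 -> nat)
    (I_gt0 : forall k, (0 < I k)%N) (rk_gt0 : forall k, (0 < rk k)%N)
    (b_gt0 : forall k, (0 < b k)%N)
    (X : tensor R I)
    (d : measure_display) (T : measurableType d) (P : probability T R)
    (xi : nat -> T -> 'I_N.+1) (zeta : nat -> T -> sample I b)
    (xi_rv : forall s A, preimages (xi s) A -> measurable A)
    (zeta_rv : forall s A, preimages (zeta s) A -> measurable A)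
    (zeta_mode : forall s w, tag (zeta s w) = xi s w)
    (Y : nat -> T -> cores R I rk) (t : nat)
    (Y_determined : forall n i r r',
      G_measurable (history xi zeta t) (fun w => Y t w n i r r'))
    (q : T -> forall n : 'I_N.+1, 'I_(J I n) -> R)
    (q_determined : forall n j,
      G_measurable (history_mode xi zeta t) (fun w => q w n j))
    (q_distr : forall w, is_distr (q w (xi t w)))
    (zeta_law : sampled_from P xi zeta t q) :
  let S w := subchain_unfold I_gt0 (Y t w) (xi t w) in
  let Rt w := residual I_gt0 X (Y t w) (xi t w) in
  let nabla w := grad X (Y t w) (xi t w) in
  let bt w := (b (xi t w))%:R : R in
  let err w :=
    sq_error I_gt0 X (Y t w) (q w (tag (zeta t w))) (tagged (zeta t w)) in
  let min_value w :=
    (bt w)^-1 * (\sum_j frob (col j (Rt w)) * frob (row j (S w))) ^+ 2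
    - (bt w)^-1 * frob (nabla w) ^+ 2 in
  [/\ (* the conditional expectation as a function of the distribution *)
      is_cond_exp P (history_mode xi zeta t) err
        (fun w => mean_sq_error b I_gt0 X (Y t w) (q w (xi t w))),
      (forall w, admissible I_gt0 X (Y t w) (q w (xi t w))) ->
      is_cond_exp P (history_mode xi zeta t) err
        (fun w =>
          (bt w)^-1 * \sum_j (q w (xi t w) j)^-1
            * frob (col j (Rt w)) ^+ 2 * frob (row j (S w)) ^+ 2
          - (bt w)^-1 * frob (nabla w) ^+ 2)
    & (forall w j, q w (xi t w) j =
        frob (col j (Rt w)) * frob (row j (S w))
        / \sum_j' frob (col j' (Rt w)) * frob (row j' (S w))) ->
      is_cond_exp P (history_mode xi zeta t) err min_value /\
      forall w, [/\ admissible I_gt0 X (Y t w) (q w (xi t w)),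
        mean_sq_error b I_gt0 X (Y t w) (q w (xi t w)) = min_value w
        & forall p : 'I_(J I (xi t w)) -> R,
          is_distr p -> admissible I_gt0 X (Y t w) p ->
          min_value w <= mean_sq_error b I_gt0 X (Y t w) p]].
Proof.
have mH A : preimages (past_of xi zeta t) A -> measurable A.
  by rewrite -history_modeE; apply: history_mode_measurable.
have Yc w w' : past_of xi zeta t w = past_of xi zeta t w' -> Y t w = Y t w'.
  move=> Hw; apply: functional_extensionality_dep => n; apply/funext => i.
  apply/matrixP => r r'.
  suff /G_measurable_preimages/(_ w w' Hw) : G_measurable
    (preimages (past_of xi zeta t)) (fun w => Y t w n i r r') by [].
  move=> B mB; rewrite -history_modeE.
  by apply: history_sub_mode; apply: Y_determined.
have qc w w' : past_of xi zeta t w = past_of xi zeta t w' -> q w = q w'.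
  move=> Hw; apply: functional_extensionality_dep => n; apply/funext => j.
  suff /G_measurable_preimages/(_ w w' Hw) :
    G_measurable (preimages (past_of xi zeta t)) (fun w => q w n j) by [].
  by rewrite -history_modeE.
move=> S Rt nabla bt err min_value.
pose e (k : sample I b) w := sq_error I_gt0 X (Y t w) (q w (tag k)) (tagged k).
(* Splitting by the value k of zeta^t separates the factor known from the past from the indicator of
   the sample. *)
have errE : err = fun w => \sum_k e k w * \1_(zeta t @^-1` [set k]) w.
  apply/funext => w; rewrite (bigD1 (zeta t w)) //= big1 ?addr0 => [|k kz].
    by rewrite indicE mem_set // mulr1.
  rewrite indicE memNset ?mulr0 //= => zk.
  by rewrite zk eqxx in kz.
have meanE : (fun w => mean_sq_error b I_gt0 X (Y t w) (q w (xi t w))) =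
    fun w => \sum_k e k w * (if tag k == xi t w
      then \prod_f q w (tag k) (tagged k f) else 0).
  apply/funext => w; transitivity (\sum_(k : sample I b | tag k == xi t w)
    e k w * \prod_f q w (tag k) (tagged k f)).
    by rewrite sum_sample; apply: eq_bigr => F _; rewrite mulrC.
  by rewrite big_mkcond; apply: eq_bigr => k _; case: ifP; rewrite ?mulr0.
have cond_mean : is_cond_exp P (history_mode xi zeta t) err
    (fun w => mean_sq_error b I_gt0 X (Y t w) (q w (xi t w))).
  rewrite errE meanE history_modeE; apply: is_cond_exp_sum => // k.
  (* [e k] is constant on the fibers of [past_of] because the iterate and q are; what remains is the
     sampling law. *)
  apply: (is_cond_exp_pull_out mH (g := e k)) => [w w' Hw|].
    by rewrite /e (Yc _ _ Hw) (qc _ _ Hw).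
  by rewrite -history_modeE; apply: zeta_law.
split=> // [adm|qopt].
  rewrite (_ : (fun w => _) =
    fun w => mean_sq_error b I_gt0 X (Y t w) (q w (xi t w))) //.
  apply/funext => w; rewrite mean_sq_errorE //; last by case: (q_distr w).
  congr (_ * _ - _); apply: eq_bigr => j _.
  by rewrite exprMn -mulrA.
(* The gradient terms cancel in this difference, so both optimality claims reduce to Cauchy-Schwarz
   and its equality case. *)
have minE w (p : 'I_(J I (xi t w)) -> R) :
    is_distr p -> admissible I_gt0 X (Y t w) p ->
    mean_sq_error b I_gt0 X (Y t w) p - min_value w =
    (bt w)^-1 * (\sum_j (p j)^-1 * weight I_gt0 X (Y t w) j ^+ 2
      - (\sum_(j < J I (xi t w)) weight I_gt0 X (Y t w) j) ^+ 2).
  move=> [_ p1] adm; rewrite mean_sq_errorE // /min_value.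
  by rewrite opprB addrA subrK mulrBr.
have opt w : [/\ admissible I_gt0 X (Y t w) (q w (xi t w)),
    mean_sq_error b I_gt0 X (Y t w) (q w (xi t w)) = min_value w
  & forall p : 'I_(J I (xi t w)) -> R,
      is_distr p -> admissible I_gt0 X (Y t w) p ->
      min_value w <= mean_sq_error b I_gt0 X (Y t w) p].
  have adm := optimal_admissible (q_distr w) (qopt w).
  split=> // [|p pd padm].
    apply/eqP; rewrite -subr_eq0 minE //.
    by rewrite (optimal_sum (q_distr w) (qopt w)) subrr mulr0.
  rewrite -subr_ge0 minE // mulr_ge0 ?invr_ge0 // subr_ge0.
  exact: sqr_sum_weight_le.
split=> //; rewrite (_ : min_value =
  fun w => mean_sq_error b I_gt0 X (Y t w) (q w (xi t w))) //.
by apply/funext => w; case: (opt w).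
Qed.
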